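(* Let $\mathrm{Q}$ be any one of the problems $\mathrm{TWDP}$, $\mathrm{TMDP}$, $\mathrm{eTMDP}$ and let $\mathrm{Q}(t)$ denote the corresponding relaxed problem $\mathrm{TWDP}(t)$, $\mathrm{TMDP}(t)$, $\mathrm{eTMDP}(t)$. Suppose that $\{t_k\}\downarrow 0$ and that $(x^k,y^k,z^k,u^k,v^k)$ is a globally optimal solution of $\mathrm{Q}(t_k)$ for each $k$. Then every accumulation point of $\{(x^k,y^k,z^k,u^k,v^k)\}$ is globally optimal to $\mathrm{Q}$.
   Context: Let $F:\mathbb{R}^{n+m}\to\mathbb{R}$ be continuously differentiable and $f:\mathbb{R}^{n+m}\to\mathbb{R}$, $g:\mathbb{R}^{n+m}\to\mathbb{R}^p$, $h:\mathbb{R}^{n+m}\to\mathbb{R}^q$ be twice continuously differentiable. Standing assumptions: the upper-level constraint is $x\in X$ with $X\subseteq\mathbb{R}^n$ nonempty, closed and convex (i.e. $\Omega=X\times\mathbb{R}^m$); for every $x\in X$ the lower-level problem $\min_y\{f(x,y): g(x,y)\le 0,\ h(x,y)=0\}$ is convex and has a nonempty solution set. Put $L(x,z,u,v)=f(x,z)+u^Tg(x,z)+v^Th(x,z)$; $\circ$ denotes the Hadamard (componentwise) product. For $t\ge 0$, the following are problems in the variables $(x,y,z,u,v)\in\mathbb{R}^n\times\mathbb{R}^m\times\mathbb{R}^m\times\mathbb{R}^p\times\mathbb{R}^q$; all minimize $F(x,y)$ and all have the common constraints $$(x,y)\in\Omega,\quad g(x,y)\le 0,\quad h(x,y)=0,\quad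 h(x,z)=0,\quad \nabla_zL(x,z,u,v)=0,\quad u\ge 0,$$ together with: - $\mathrm{TWDP}(t)$: $f(x,y)-f(x,z)-u^Tg(x,z)\le t$; - $\mathrm{TMDP}(t)$: $f(x,y)-f(x,z)\le t$ and $u^Tg(x,z)\ge 0$; - $\mathrm{eTMDP}(t)$: $f(x,y)-f(x,z)\le t$ and $u\circ g(x,z)\ge 0$. $\mathrm{TWDP}$, $\mathrm{TMDP}$, $\mathrm{eTMDP}$ denote these problems with $t=0$. $\{t_k\}\downarrow0$ means that $t_k>0$ decreases to $0$. *)

(* Defs.v *)
From mathcomp Require Import all_boot all_order all_algebra.
From mathcomp Require Import all_classical all_reals all_analysis.

Set Implicit Arguments.
Unset Strict Implicit.
Unset Printing Implicit Defensive.

Import Order.TTheory GRing.Theory Num.Theory.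
Import numFieldNormedType.Exports.

Local Open Scope classical_set_scope.
Local Open Scope ring_scope.

Section Vectors.
Context {R : realType}.

Definition vle k (a b : 'rV[R]_k) : Prop := forall i, a 0 i <= b 0 i.

Definition dot k (a b : 'rV[R]_k) : R := \sum_i a 0 i * b 0 i.

Definition hadamard k (a b : 'rV[R]_k) : 'rV[R]_k := map2_mx *%R a b.

Definition gradient k (phi : 'rV[R]_k -> R) (x : 'rV[R]_k) : 'rV[R]_k :=
  \row_i 'D_(delta_mx 0 i) phi x.

Definition C1 k (phi : 'rV[R]_k -> R) : Prop :=
  (forall x, differentiable phi x) /\ continuous (gradient phi).

Definition C2 k (phi : 'rV[R]_k -> R) : Prop :=
  C1 phi /\ forall i, C1 (fun x => gradient phi x 0 i).

Definition C2_vec k l (G : 'rV[R]_k -> 'rV[R]_l) : Prop :=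
  forall i, C2 (fun x => G x 0 i).

Definition affine k l (G : 'rV[R]_k -> 'rV[R]_l) : Prop :=
  exists (A : 'M[R]_(k, l)) (b : 'rV[R]_l), forall y, G y = y *m A + b.

Definition convex_program k p q (phi : 'rV[R]_k -> R)
    (gam : 'rV[R]_k -> 'rV[R]_p) (eta : 'rV[R]_k -> 'rV[R]_q) : Prop :=
  [/\ convex_function setT phi,
      forall i, convex_function setT (fun y => gam y 0 i) &
      affine eta].

Definition global_minimizers (T : Type) (phi : T -> R) (A : set T) : set T :=
  [set a | A a /\ forall b, A b -> phi a <= phi b].

End Vectors.

Inductive duality := TWDP | TMDP | eTMDP.

Section Bilevel.
Context {R : realType} {n m p q : nat}.

(* The variables (x, y, z, u, v) *)
Definition primal_dual : Type :=
  ('rV[R]_n * 'rV[R]_m * 'rV[R]_m * 'rV[R]_p * 'rV[R]_q)%type.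

Variables (X : set 'rV[R]_n) (F f : 'rV[R]_(n + m) -> R).
Variables (g : 'rV[R]_(n + m) -> 'rV[R]_p) (h : 'rV[R]_(n + m) -> 'rV[R]_q).

Definition lower_feasible (x : 'rV[R]_n) : set 'rV[R]_m :=
  [set y | vle (g (row_mx x y)) 0 /\ h (row_mx x y) = 0].

Definition lower_solutions (x : 'rV[R]_n) : set 'rV[R]_m :=
  global_minimizers (fun y => f (row_mx x y)) (lower_feasible x).

Definition lower_convex (x : 'rV[R]_n) : Prop :=
  convex_program (fun y => f (row_mx x y)) (fun y => g (row_mx x y))
    (fun y => h (row_mx x y)).

Definition Omega : set ('rV[R]_n * 'rV[R]_m) := X `*` setT.

Definition lagrangian (x : 'rV[R]_n) (z : 'rV[R]_m) (u : 'rV[R]_p)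
    (v : 'rV[R]_q) : R :=
  f (row_mx x z) + dot u (g (row_mx x z)) + dot v (h (row_mx x z)).

Definition common_constraints : set primal_dual :=
  [set w | let: (x, y, z, u, v) := w in
    [/\ [/\ Omega (x, y), vle (g (row_mx x y)) 0 & h (row_mx x y) = 0],
        h (row_mx x z) = 0,
        gradient (fun z' => lagrangian x z' u v) z = 0 &
        vle 0 u]].

Definition duality_constraints (Q : duality) (t : R) : set primal_dual :=
  [set w | let: (x, y, z, u, v) := w in
    match Q with
    | TWDP =>
        f (row_mx x y) - f (row_mx x z) - dot u (g (row_mx x z)) <= t
    | TMDP =>
        f (row_mx x y) - f (row_mx x z) <= t /\ 0 <= dot u (g (row_mx x z))
    | eTMDP =>
        f (row_mx x y) - f (row_mx x z) <= t /\
        vle 0 (hadamard u (g (row_mx x z)))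
    end].

Definition objective (w : primal_dual) : R :=
  let: (x, y, _, _, _) := w in F (row_mx x y).

Definition relaxed_solutions (Q : duality) (t : R) : set primal_dual :=
  global_minimizers objective (common_constraints `&` duality_constraints Q t).

Definition problem_solutions (Q : duality) : set primal_dual :=
  relaxed_solutions Q 0.

End Bilevel.

Arguments primal_dual : clear implicits.

(* Main.v *)
Require Import Defs.
From mathcomp Require Import all_boot all_order all_algebra.
From mathcomp Require Import all_classical all_reals all_analysis.

(** The theorem is a closedness argument.  For every [t] the feasible set of
    the relaxed problem [Q(t)] is closed: each constraint is an equality or a
    weak inequality between continuous functions of [(x, y, z, u, v)], or the
    membership of [x] in the closed set [X].  The feasible sets grow with [t],
    and their intersection over all [t > 0] is the feasible set of [Q].  Hence
    an accumulation point of the sequence, whose terms lie eventually in the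
    feasible set of [Q(s)] for every [s > 0], is feasible for [Q].  Moreover a
    point [b] feasible for [Q] is feasible for every [Q(t_k)], so
    [F(x^k, y^k)] is at most the value of the objective at [b] for all [k],
    and this bound passes to accumulation points because [F] is continuous.
    The lemma [cluster_global_minimizers] is this argument for an arbitrary
    family of sets.

    What remains is the continuity of the constraints.  The only one that is
    not immediate is stationarity of the Lagrangian, as it involves a
    derivative in [z] for a fixed [x]: the chain rule [gradient_lagrangian]
    rewrites it in terms of the total gradients of [f] and of the components
    of [g] and [h], which are continuous at [(x, z)] jointly, and of the
    multipliers, on which it depends affinely. *)

Set Implicit Arguments.
Unset Strict Implicit.
Unset Printing Implicit Defensive.

Import Order.TTheory GRing.Theory Num.Theory.
Import numFieldNormedType.Exports.

Local Open Scope classical_set_scope.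
Local Open Scope ring_scope.

(** * Accumulation points of minimizers over a family of closed sets *)

Section ClosedSets.
Context (R : realType) (T : topologicalType).
Implicit Types (phi : T -> R) (w : nat -> T).

Lemma closed_sublevel phi c :
  continuous phi -> closed [set w | phi w <= c].
Proof.
by move=> phic; apply: (preimage_closed _ (@closed_le R c)) => w _; exact: phic.
Qed.

Lemma closed_superlevel phi c :
  continuous phi -> closed [set w | c <= phi w].
Proof.
by move=> phic; apply: (preimage_closed _ (@closed_ge R c)) => w _; exact: phic.
Qed.

Lemma closed_level phi c :
  continuous phi -> closed [set w | phi w = c].
Proof.
by move=> phic; apply: (preimage_closed _ (@closed_eq R c)) => w _; exact: phic.
Qed.

Lemma closed_forall (I : Type) (P : I -> T -> Prop) :
  (forall i, closed [set w | P i w]) -> closed [set w | forall i, P i w].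
Proof.
move=> Pc; rewrite (_ : mkset _ = \bigcap_(i in setT) [set w | P i w]).
  by apply: closed_bigI => i _; exact: Pc.
by apply/seteqP; split => w /= Pw i => [_|]; exact: Pw.
Qed.

Lemma cluster_closed w (A : set T) x :
  closed A -> (\forall k \near \oo, A (w k)) -> cluster (w @ \oo) x -> A x.
Proof. by move=> Ac wA; rewrite clusterE => /(_ A wA) /Ac. Qed.

(** Feasibility of a limit comes from the convergence of the parameters to
    [0].  Its optimality comes from a bound that holds at every term of the
    sequence: the minimization over [A (t k)] competes with all of [A 0]. *)
Lemma cluster_global_minimizers phi (A : R -> set T) (t : nat -> R) w :
  continuous phi -> (forall s, closed (A s)) ->
  {homo A : r s / r <= s >-> r `<=` s} ->
  (forall x, (forall s, 0 < s -> A s x) -> A 0 x) ->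
  (forall k, 0 <= t k) -> t @ \oo --> (0 : R) ->
  (forall k, global_minimizers phi (A (t k)) (w k)) ->
  cluster (w @ \oo) `<=` global_minimizers phi (A 0).
Proof.
move=> phic Ac Amono A0 t0 tcvg wopt x xw; split=> [|b Ab].
  apply: A0 => s s0; apply: (cluster_closed (w := w)) xw; first exact: Ac.
  near=> k; have tks : t k <= s by apply: ltW; near: k; exact: (cvgr_lt 0).
  by apply: (Amono _ _ tks); have [] := wopt k.
apply: (cluster_closed (w := w) (A := [set y | phi y <= phi b])) xw.
  exact: closed_sublevel.
by near=> k; have [_] := wopt k; apply; exact: (Amono _ _ (t0 k)).
Unshelve. all: by end_near. Qed.

End ClosedSets.

(** * Continuity of vector-valued expressions *)

Lemma continuous_mx (T S : topologicalType) (m n : nat)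
    (A : T -> 'M[S]_(m, n)) :
  (forall i j, continuous (fun w => A w i j)) -> continuous A.
Proof.
move=> Ac w B [P nP PB].
suff : nbhs w [set w' | forall i j, P i j (A w' i j)].
  by apply: filterS => w' /= /PB.
apply: filter_forall => i; apply: filter_forall => j.
exact: Ac (nP i j).
Qed.

Section VectorContinuity.
Context (R : realType) (T : topologicalType).

Lemma continuous_entry k (a : T -> 'rV[R]_k) i :
  continuous a -> continuous (fun w => a w 0 i).
Proof.
by move=> ac w; exact: (continuous_comp (ac w) (@coord_continuous _ _ _ 0 i _)).
Qed.

Lemma continuous_row_mx n m (a : T -> 'rV[R]_n) (b : T -> 'rV[R]_m) :
  continuous a -> continuous b -> continuous (fun w => row_mx (a w) (b w)).
Proof.
move=> ac bc; apply: continuous_mx => i j.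
rewrite ord1 (_ : (fun w => _) = (fun w => match fintype.split j with
  | inl k => a w 0 k | inr k => b w 0 k end)); last first.
  by apply/funext => w; rewrite mxE.
by case: (fintype.split j) => k; exact: continuous_entry.
Qed.

Lemma continuous_at_row_mx n m (phi : 'rV[R]_(n + m) -> R)
    (a : T -> 'rV[R]_n) (b : T -> 'rV[R]_m) :
  continuous phi -> continuous a -> continuous b ->
  continuous (fun w => phi (row_mx (a w) (b w))).
Proof.
move=> phic ac bc w.
exact: (continuous_comp (continuous_row_mx ac bc (x:=w)) (phic _)).
Qed.

Lemma continuous_dot k (a b : T -> 'rV[R]_k) :
  (forall i, continuous (fun w => a w 0 i)) ->
  (forall i, continuous (fun w => b w 0 i)) ->
  continuous (fun w => dot (a w) (b w)).
Proof.
move=> ac bc; apply: continuous_big => [|i _]; first exact: add_continuous.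
by move=> w; apply: continuousM; [exact: ac|exact: bc].
Qed.

End VectorContinuity.

Section Smoothness.
Context (R : realType) (k : nat) (phi : 'rV[R]_k -> R).

Lemma C1_continuous : C1 phi -> continuous phi.
Proof. by move=> [phid _] y; exact: differentiable_continuous. Qed.

Lemma C1_continuous_partial i :
  C1 phi -> continuous (fun y => gradient phi y 0 i).
Proof. by move=> [_ gc]; exact: continuous_entry. Qed.

End Smoothness.

(** * The gradient of the Lagrangian in the lower-level variable *)

Section PartialGradient.
Context (R : realType) (n m : nat).
Implicit Types (phi : 'rV[R]_(n + m) -> R) (x : 'rV[R]_n) (z : 'rV[R]_m).

(** Moving [z] along a basis vector moves [(x, z)] along a basis vector of the
    product, so the two derivatives are limits of the same quotient. *)
Lemma difference_quotient_row_mx phi x z i :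
  (fun e : R => e^-1 *: (phi (row_mx x (e *: delta_mx 0 i + z))
                         - phi (row_mx x z))) =
  (fun e => e^-1 *: (phi (e *: delta_mx 0 (rshift n i) + row_mx x z)
                     - phi (row_mx x z))).
Proof.
apply/funext => e; congr (_ *: (phi _ - _)).
apply/rowP => j; rewrite !mxE/=; case: splitP => k jk; rewrite ?mxE /=.
  rewrite (_ : j == _ = false) ?mulr0 ?add0r//.
  apply/eqP => /(congr1 val) /=; rewrite jk => E.
  by have := ltn_ord k; rewrite E ltnNge leq_addr.
by rewrite -!val_eqE /= jk eqn_add2l.
Qed.

Lemma derivable_row_mx phi x z i :
  differentiable phi (row_mx x z) ->
  derivable (fun z' => phi (row_mx x z')) z (delta_mx 0 i).
Proof.
move=> /diff_derivable - /(_ (delta_mx 0 (rshift n i))).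
by rewrite /derivable /= difference_quotient_row_mx.
Qed.

Lemma derive_row_mx phi x z i :
  'D_(delta_mx 0 i) (fun z' => phi (row_mx x z')) z =
  gradient phi (row_mx x z) 0 (rshift n i).
Proof. by rewrite mxE /derive /= difference_quotient_row_mx. Qed.

(** The column is stored as a row vector so that [dot] can pair it with a
    multiplier. *)
Definition jacobian_col k (G : 'rV[R]_(n + m) -> 'rV[R]_k) x z (i : 'I_m)
    : 'rV[R]_k :=
  \row_j gradient (fun y => G y 0 j) (row_mx x z) 0 (rshift n i).

Lemma is_derive_dot_row_mx k (c : 'rV[R]_k) (G : 'rV[R]_(n + m) -> 'rV[R]_k)
    x z i :
  (forall j, differentiable (fun y => G y 0 j) (row_mx x z)) ->
  is_derive z (delta_mx 0 i) (fun z' => dot c (G (row_mx x z')))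
    (dot c (jacobian_col G x z i)).
Proof.
move=> Gd.
have Dj j : derivable (fun z' => G (row_mx x z') 0 j) z (delta_mx 0 i).
  exact: (derivable_row_mx (phi := fun y => G y 0 j)).
rewrite (_ : (fun z' => _) =
    \sum_j (c 0 j \*: (fun z' => G (row_mx x z') 0 j))); last first.
  by apply/funext => z'; rewrite fct_sumE.
apply: DeriveDef.
  by apply: derivable_sum => j; exact: derivableZ.
rewrite derive_sum => [|j]; last exact: derivableZ.
apply: eq_bigr => j _; rewrite deriveZ// mxE; congr (_ * _).
exact: (derive_row_mx (fun y => G y 0 j)).
Qed.

(** The right-hand side is where joint continuity in [(x, z, u, v)] becomes
    visible: on the left, [x], [u] and [v] are parameters of the function that
    is differentiated. *)
Lemma gradient_lagrangian p q (f : 'rV[R]_(n + m) -> R)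
    (g : 'rV[R]_(n + m) -> 'rV[R]_p) (h : 'rV[R]_(n + m) -> 'rV[R]_q)
    x z u v i :
  C2 f -> C2_vec g -> C2_vec h ->
  gradient (fun z' => lagrangian f g h x z' u v) z 0 i =
  gradient f (row_mx x z) 0 (rshift n i) +
  dot u (jacobian_col g x z i) + dot v (jacobian_col h x z i).
Proof.
move=> [[fd _] _] gC hC.
have Df := @derivable_row_mx f x z i (fd _).
have Dg := @is_derive_dot_row_mx _ u g x z i (fun j => (gC j).1.1 _).
have Dh := @is_derive_dot_row_mx _ v h x z i (fun j => (hC j).1.1 _).
rewrite mxE /lagrangian [LHS]deriveD//; last exact: derivableD.
by rewrite deriveD// derive_row_mx !derive_val.
Qed.

Lemma continuous_jacobian_col (T : topologicalType) k
    (G : 'rV[R]_(n + m) -> 'rV[R]_k) (a : T -> 'rV[R]_n) (b : T -> 'rV[R]_m)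
    i j :
  C2_vec G -> continuous a -> continuous b ->
  continuous (fun w => jacobian_col G (a w) (b w) i 0 j).
Proof.
move=> GC ac bc; under eq_fun do rewrite mxE.
apply: (continuous_at_row_mx
  (phi := fun y => gradient (fun y => G y 0 j) y 0 (rshift n i))) => //.
exact: C1_continuous_partial (GC j).1.
Qed.

End PartialGradient.

(** * Closedness of the relaxed feasible sets *)

Section Feasibility.
Context (R : realType) (n m p q : nat).
Implicit Types (f : 'rV[R]_(n + m) -> R) (g : 'rV[R]_(n + m) -> 'rV[R]_p).
Implicit Types (h : 'rV[R]_(n + m) -> 'rV[R]_q).

Local Notation W := (primal_dual R n m p q).

Definition xvar (w : W) : 'rV[R]_n := w.1.1.1.1.
Definition yvar (w : W) : 'rV[R]_m := w.1.1.1.2.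
Definition zvar (w : W) : 'rV[R]_m := w.1.1.2.
Definition uvar (w : W) : 'rV[R]_p := w.1.2.
Definition vvar (w : W) : 'rV[R]_q := w.2.

Lemma continuous_fst_comp (T U V : topologicalType) (k : T -> U * V) :
  continuous k -> continuous (fun w => (k w).1).
Proof. by move=> kc w; apply: (continuous_comp (kc w)); exact: cvg_fst. Qed.

Lemma continuous_snd_comp (T U V : topologicalType) (k : T -> U * V) :
  continuous k -> continuous (fun w => (k w).2).
Proof. by move=> kc w; apply: (continuous_comp (kc w)); exact: cvg_snd. Qed.

Lemma vvar_continuous : continuous vvar.
Proof. by apply: continuous_snd_comp => w; exact: cvg_id. Qed.

Lemma uvar_continuous : continuous uvar.
Proof.
by apply/continuous_snd_comp/continuous_fst_comp => w; exact: cvg_id.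
Qed.

Lemma zvar_continuous : continuous zvar.
Proof.
apply/continuous_snd_comp/continuous_fst_comp/continuous_fst_comp => w.
exact: cvg_id.
Qed.

Lemma yvar_continuous : continuous yvar.
Proof.
apply/continuous_snd_comp/continuous_fst_comp/continuous_fst_comp.
by apply/continuous_fst_comp => w; exact: cvg_id.
Qed.

Lemma xvar_continuous : continuous xvar.
Proof.
apply/continuous_fst_comp/continuous_fst_comp/continuous_fst_comp.
by apply/continuous_fst_comp => w; exact: cvg_id.
Qed.

Lemma continuous_at_xy (phi : 'rV[R]_(n + m) -> R) :
  continuous phi -> continuous (fun w => phi (row_mx (xvar w) (yvar w))).
Proof.
move=> phic; apply: continuous_at_row_mx => //; first exact: xvar_continuous.
exact: yvar_continuous.
Qed.

Lemma continuous_at_xz (phi : 'rV[R]_(n + m) -> R) :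
  continuous phi -> continuous (fun w => phi (row_mx (xvar w) (zvar w))).
Proof.
move=> phic; apply: continuous_at_row_mx => //; first exact: xvar_continuous.
exact: zvar_continuous.
Qed.

Lemma continuous_objective (F : 'rV[R]_(n + m) -> R) :
  continuous F -> continuous (objective F : W -> R).
Proof.
move=> Fc; rewrite (_ : objective F =
    (fun w : W => F (row_mx (xvar w) (yvar w)))).
  exact: continuous_at_xy.
by apply/funext => -[[[[x y] z] u] v].
Qed.

Lemma continuous_lagrangian_stationarity f g h i :
  C2 f -> C2_vec g -> C2_vec h ->
  continuous (fun w : W =>
    gradient (fun z => lagrangian f g h (xvar w) z (uvar w) (vvar w))
      (zvar w) 0 i).
Proof.
move=> fC gC hC; under eq_fun do rewrite gradient_lagrangian//.
have xc := xvar_continuous; have zc := zvar_continuous.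
have addc (a b : W -> R) : continuous a -> continuous b ->
    continuous (fun w => a w + b w).
  by move=> ac bc w; apply: continuousD; [exact: ac|exact: bc].
apply: (addc); first apply: (addc).
- apply: (continuous_at_xz (phi := fun y => gradient f y 0 (rshift n i))).
  exact: C1_continuous_partial fC.1.
- apply: continuous_dot => j.
    exact: continuous_entry uvar_continuous.
  exact: continuous_jacobian_col.
- apply: continuous_dot => j.
    exact: continuous_entry vvar_continuous.
  exact: continuous_jacobian_col.
Qed.

Lemma closed_common_constraints X f g h :
  closed X -> C2 f -> C2_vec g -> C2_vec h ->
  closed (common_constraints X f g h).
Proof.
move=> Xcl fC gC hC.
have gc j := C1_continuous (gC j).1; have hc j := C1_continuous (hC j).1.
rewrite (_ : common_constraints X f g h =
  (xvar @^-1` X) `&`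
  [set w | forall j, g (row_mx (xvar w) (yvar w)) 0 j <= 0] `&`
  [set w | forall j, h (row_mx (xvar w) (yvar w)) 0 j = 0] `&`
  [set w | forall j, h (row_mx (xvar w) (zvar w)) 0 j = 0] `&`
  [set w | forall i,
    gradient (fun z => lagrangian f g h (xvar w) z (uvar w) (vvar w))
      (zvar w) 0 i = 0] `&`
  [set w | forall j, 0 <= uvar w 0 j]).
  do ![apply: closedI].
  - by apply: (preimage_closed _ Xcl) => w _; exact: xvar_continuous.
  - apply: closed_forall => j; apply: closed_sublevel.
    exact: (continuous_at_xy (gc j)).
  - apply: closed_forall => j; apply: closed_level.
    exact: (continuous_at_xy (hc j)).
  - apply: closed_forall => j; apply: closed_level.
    exact: (continuous_at_xz (hc j)).
  - apply: closed_forall => i; apply: closed_level.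
    exact: continuous_lagrangian_stationarity.
  - apply: closed_forall => j; apply: closed_superlevel.
    exact: continuous_entry uvar_continuous.
have vec0 k (a : 'rV[R]_k) : (a = 0) = (forall j, a 0 j = 0).
  apply/propext; split=> [-> j|a0]; first by rewrite mxE.
  by apply/rowP => j; rewrite a0 mxE.
have vle0 k (a : 'rV[R]_k) : vle a 0 = (forall j, a 0 j <= 0).
  by apply/propext; split=> a0 j; have := a0 j; rewrite mxE.
have vge0 k (a : 'rV[R]_k) : vle 0 a = (forall j, 0 <= a 0 j).
  by apply/propext; split=> a0 j; have := a0 j; rewrite mxE.
apply/seteqP; split=> -[[[[x y] z] u] v] /=; rewrite !vec0 vle0 vge0.
  by move=> [[[Xx _] gxy hxy] hxz Lz u0].
by move=> [[[[[Xx gxy] hxy] hxz] Lz] u0].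
Qed.

Lemma closed_duality_constraints f g Q t : C2 f -> C2_vec g ->
  closed (duality_constraints f g Q t : set W).
Proof.
move=> fC gC.
have fxy := continuous_at_xy (C1_continuous fC.1).
have fxz := continuous_at_xz (C1_continuous fC.1).
have uc j : continuous (fun w : W => uvar w 0 j).
  exact: continuous_entry uvar_continuous.
have gxz j : continuous (fun w : W => g (row_mx (xvar w) (zvar w)) 0 j).
  exact: (continuous_at_xz (C1_continuous (gC j).1)).
have ugc := continuous_dot uc gxz.
have gapc : continuous (fun w : W =>
    f (row_mx (xvar w) (yvar w)) - f (row_mx (xvar w) (zvar w))).
  by move=> w; apply: continuousB; [exact: fxy|exact: fxz].
case: Q.
- rewrite (_ : duality_constraints _ _ _ _ = [set w : W |
    f (row_mx (xvar w) (yvar w)) - f (row_mx (xvar w) (zvar w)) -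
    dot (uvar w) (g (row_mx (xvar w) (zvar w))) <= t]).
    apply: closed_sublevel => w.
    exact: (continuousB (gapc w) (ugc w)).
  by apply/seteqP; split=> -[[[[x y] z] u] v].
- rewrite (_ : duality_constraints _ _ _ _ = [set w : W |
    f (row_mx (xvar w) (yvar w)) - f (row_mx (xvar w) (zvar w)) <= t] `&`
    [set w | 0 <= dot (uvar w) (g (row_mx (xvar w) (zvar w)))]).
    by apply: closedI; [exact: closed_sublevel|exact: closed_superlevel].
  by apply/seteqP; split=> -[[[[x y] z] u] v].
- rewrite (_ : duality_constraints _ _ _ _ = [set w : W |
    f (row_mx (xvar w) (yvar w)) - f (row_mx (xvar w) (zvar w)) <= t] `&`
    [set w | forall j,
      0 <= uvar w 0 j * g (row_mx (xvar w) (zvar w)) 0 j]).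
    apply: closedI; first exact: closed_sublevel.
    apply: closed_forall => j; apply: closed_superlevel => w.
    by apply: continuousM; [exact: uc|exact: gxz].
  by apply/seteqP; split=> -[[[[x y] z] u] v] /= [fyz ug]; split=> // j;
    have := ug j; rewrite !mxE.
Qed.

Lemma duality_constraints_homo f g Q :
  {homo (duality_constraints f g Q : R -> set W)
    : s t / s <= t >-> s `<=` t}.
Proof.
move=> s t st [[[[x y] z] u] v]; case: Q => /=.
- by move=> /le_trans; exact.
- by move=> [/le_trans fs ug]; split => //; exact: fs.
- by move=> [/le_trans fs ug]; split => //; exact: fs.
Qed.

(** The relaxation parameter only enters as an upper bound of a fixed
    quantity; the sign conditions of [TMDP] and [eTMDP] are the same for every
    [s], hence can be read off at [s = 1]. *)
Lemma duality_constraints0 f g Q (w : W) :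
  (forall s, 0 < s -> duality_constraints f g Q s w) ->
  duality_constraints f g Q 0 w.
Proof.
move: w => [[[[x y] z] u] v]; case: Q => /= H.
- by apply/ler_addgt0Pr => s /H; rewrite add0r.
- split; last by have [] := H 1 ltr01.
  by apply/ler_addgt0Pr => s /H[]; rewrite add0r.
- split; last by have [] := H 1 ltr01.
  by apply/ler_addgt0Pr => s /H[]; rewrite add0r.
Qed.

End Feasibility.

Theorem theorem4p1 (R : realType) (n m p q : nat)
  (X : set 'rV[R]_n) (F f : 'rV[R]_(n + m) -> R)
  (g : 'rV[R]_(n + m) -> 'rV[R]_p) (h : 'rV[R]_(n + m) -> 'rV[R]_q)
  (F_C1 : C1 F) (f_C2 : C2 f) (g_C2 : C2_vec g) (h_C2 : C2_vec h)
  (X_nonempty : X !=set0) (X_closed : closed X) (X_convex : convex_set X)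
  (lower_is_convex : forall x, X x -> lower_convex f g h x)
  (lower_solvable : forall x, X x -> lower_solutions f g h x !=set0)
  (Q : duality) (t : nat -> R) (w : nat -> primal_dual R n m p q)
  (t_gt0 : forall k, 0 < t k)
  (t_decreasing : nonincreasing_seq t)
  (t_cvg0 : t @ \oo --> (0 : R))
  (w_optimal : forall k, relaxed_solutions X F f g h Q (t k) (w k)) :
  forall wbar : primal_dual R n m p q,
    cluster (w @ \oo) wbar -> problem_solutions X F f g h Q wbar.
Proof.
apply: (@cluster_global_minimizers _ _ (objective F)
  (fun s => common_constraints X f g h `&` duality_constraints f g Q s) t) => //.
- exact: continuous_objective (C1_continuous F_C1).
- move=> s; apply: closedI; first exact: closed_common_constraints.
  exact: closed_duality_constraints.
- by move=> r s rs; apply: setIS; exact: duality_constraints_homo.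
- move=> x Ax; split; first by have [] := Ax 1 ltr01.
  by apply: duality_constraints0 => s /Ax[].
- by move=> k; exact: ltW.
Qed.
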